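(* Let $\{x^k\}_{k\ge1}$ be generated by the block stochastic gradient (BSG) method (described in the context; no convexity of $F$ or $r_i$ is assumed), with stepsizes $\alpha_i^k=c_i^k\beta_k$, where $c_i^k,\beta_k$ are positive scalars such that $\beta_k\ge\beta_{k+1}$ for all $k$, $$0<\inf_kc_i^k\le\sup_kc_i^k<\infty\quad\text{for all }i,\qquad\sum_{k=1}^\infty\beta_k=+\infty,\qquad\sum_{k=1}^\infty\beta_k^2<+\infty.$$ Assume: (1) there are a constant $A$ and a sequence $\{\sigma_k\}$ such that for all $i,k$: $\big\|\mathbb E[\delta_i^k\mid\mathbf\Xi_{[k-1]}]\big\|\le A\max_j\alpha_j^k$ and $\mathbb E\|\delta_i^k\|^2\le\sigma_k^2$; (2) $\Phi$ is bounded below, and there is $L>0$ such that $\|\nabla_{x_i}F(x)-\nabla_{x_i}F(y)\|\le L\|x-y\|$ for all $x,y$ and all $i$; (3) there is a constant $\rho$ such that $\mathbb E\|x^k\|^2\le\rho^2$ for all $k$; (4) every $r_i$ is Lipschitz continuous: there is $L_{r_i}$ with $|r_i(x_i)-r_i(y_i)|\le L_{r_i}\|x_i-y_i\|$ for all $x_i,y_i$. If for each $i$ either $\mathcal X_i=\mathbb R^{n_i}$ or $r_i=0$, and $$\sum_{k=1}^\infty\beta_k\sigma_k^2<\infty,$$ then there exists an (infinite) index subsequence $\mathcal K$ such that $$\lim_{\substack{k\to\infty\\k\in\mathcal K}}\mathbb E\big[\mathrm{dist}\big(0,\partial\hat\Phi(x^k)\big)\big]=0,$$ where $\hat\Phi(x)=F(x)+\sum_{i=1}^s\hat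 r_i(x_i)$, with $\hat r_i=r_i$ if $\mathcal X_i=\mathbb R^{n_i}$ and $\hat r_i=\iota_{\mathcal X_i}$ otherwise.
   Context: Problem. Minimize $\Phi(x)=F(x)+\sum_{i=1}^sr_i(x_i)$ with $F(x)=\mathbb E_\xi f(x;\xi)$, subject to $x_i\in\mathcal X_i$, $i=1,\dots,s$. Here $\xi$ is a random variable, $x=(x_1,\dots,x_s)\in\mathbb R^n$ is partitioned into blocks $x_i\in\mathbb R^{n_i}$, $\mathcal X_i\subset\mathbb R^{n_i}$ are convex, $F$ is continuously differentiable, and $r_i$ are (possibly non-differentiable) regularization functions on $\mathbb R^{n_i}$. $\|\cdot\|$ is the Euclidean norm, $x_{<i}=(x_1,\dots,x_{i-1})$, and similarly $x_{\ge i}$; $\nabla_{x_i}$ is the partial gradient in block $i$. $\iota_{\mathcal C}$ is the indicator function of $\mathcal C$ ($0$ on $\mathcal C$, $+\infty$ elsewhere), $\partial$ is the limiting subdifferential (Rockafellar–Wets), and $\mathrm{dist}(y,\mathcal C)=\min_{x\in\mathcal C}\|x-y\|$. BSG method. Given a starting point $x^1$, stepsizes $\alpha_i^k>0$, and positive integers $m_k$: at iteration $k=1,2,\dots$ draw a random mini-batch $\Xi_k=\{\xi_{k,1},\dots,\xi_{k,m_k}\}$ of samples of $\xi$; then for $i=1,\dots,s$ in this order compute $$\tilde g_i^k=\frac1{m_k}\sum_{\ell=1}^{m_k}\nabla_{x_i}f(x_{<i}^{k+1},x_{\ge i}^k;\xi_{k,\ell})$$ and update block $i$: if $\mathcal X_i=\mathbb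 R^{n_i}$, $$x_i^{k+1}=\arg\min_{x_i}\ \langle\tilde g_i^k,x_i-x_i^k\rangle+\tfrac1{2\alpha_i^k}\|x_i-x_i^k\|^2+r_i(x_i);$$ otherwise, $$x_i^{k+1}=\arg\min_{x_i\in\mathcal X_i}\ \langle\tilde g_i^k+\tilde\nabla r_i(x_i^k),x_i-x_i^k\rangle+\tfrac1{2\alpha_i^k}\|x_i-x_i^k\|^2,$$ where $\tilde\nabla r_i(x_i^k)$ is a subgradient of $r_i$ at $x_i^k$ (assumed to exist). Both subproblems are assumed to be solvable (when the minimizer is not unique, $x_i^{k+1}$ is any minimizer). Notation: $g_i^k=\nabla_{x_i}F(x_{<i}^{k+1},x_{\ge i}^k)$, $\delta_i^k=\tilde g_i^k-g_i^k$, $\mathbf\Xi_{[k]}=(\Xi_1,\dots,\Xi_k)$; $\mathbb E[\cdot\mid\cdot]$ is conditional expectation. *)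

(* Defs.v *)
From HB Require Import structures.
From mathcomp Require Export all_boot all_order all_algebra.
From mathcomp Require Export all_classical all_reals all_analysis.
Export Order.TTheory GRing.Theory Num.Theory numFieldNormedType.Exports.

Set Implicit Arguments.
Unset Strict Implicit.
Unset Printing Implicit Defensive.

Local Open Scope classical_set_scope.
Local Open Scope ring_scope.

Section Euclidean.
Context {R : realType} {p : nat}.
Implicit Types u v : 'rV[R]_p.

Definition dotv u v : R := \sum_j u 0 j * v 0 j.

(* The library norm [`|u|] on matrices is the sup norm; it induces the same
   topology, so [-->] and [differentiable] below need no adaptation. *)
Definition enorm u : R := Num.sqrt (dotv u u).

(* +oo when [C] is empty. *)
Definition edist_to u (C : set 'rV[R]_p) : \bar R :=
  ereal_inf [set (enorm (y - u))%:E | y in C].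

Definition grad (h : 'rV[R]_p -> R) (x : 'rV[R]_p) : 'rV[R]_p :=
  \row_j 'D_(delta_mx 0 j) h x.

Definition argmin_on (C : set 'rV[R]_p) (h : 'rV[R]_p -> R) : set 'rV[R]_p :=
  [set x | C x /\ forall y, C y -> h x <= h y].

Definition indic_fun (C : set 'rV[R]_p) (x : 'rV[R]_p) : \bar R :=
  if `[< C x >] then 0%E else +oo%E.

(* Regular and limiting subdifferentials (Rockafellar-Wets, Definition 8.3);
   the o(|y - x|) term is spelled out with epsilons. *)
Definition regular_subdiff (h : 'rV[R]_p -> \bar R) (x : 'rV[R]_p)
    : set 'rV[R]_p :=
  [set v | h x \is a fin_num /\
    forall eps : R, 0 < eps -> \forall y \near x,
      (h x + (dotv v (y - x) - eps * enorm (y - x))%:E <= h y)%E].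

Definition limiting_subdiff (h : 'rV[R]_p -> \bar R) (x : 'rV[R]_p)
    : set 'rV[R]_p :=
  [set v | h x \is a fin_num /\
    exists (xs vs : nat -> 'rV[R]_p),
      [/\ xs @ \oo --> x, (h \o xs) @ \oo --> h x,
          (forall t, regular_subdiff h (xs t) (vs t)) & vs @ \oo --> v]].

End Euclidean.

Section Blocks.
Context {R : realType} {s : nat} {n_ : 'I_s -> nat}.
Implicit Types x : 'rV[R]_(\sum_i n_ i).

Definition set_block x (i : 'I_s) (y : 'rV[R]_(n_ i)) : 'rV[R]_(\sum_i n_ i) :=
  \mxrow_j (if @eqP _ j i is ReflectT e then
              castmx (erefl, congr1 n_ (esym e)) y
            else submxrow x j).

Definition pdifferentiable (h : 'rV[R]_(\sum_i n_ i) -> R) (i : 'I_s) x : Prop :=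
  differentiable (fun y => h (@set_block x i y)) (submxrow x i).

Definition pgrad (h : 'rV[R]_(\sum_i n_ i) -> R) (i : 'I_s) x : 'rV[R]_(n_ i) :=
  grad (fun y => h (@set_block x i y)) (submxrow x i).

(* [mix_blocks x' x i] is (x'_{<i}, x_{>=i}). *)
Definition mix_blocks (x' x : 'rV[R]_(\sum_i n_ i)) (i : 'I_s)
    : 'rV[R]_(\sum_i n_ i) :=
  \mxrow_j (if (j < i)%N then submxrow x' j else submxrow x j).

Definition objective (F : 'rV[R]_(\sum_i n_ i) -> R)
    (r : forall i, 'rV[R]_(n_ i) -> R) x : R :=
  F x + \sum_i r i (submxrow x i).

Definition r_hat (X : forall i, set 'rV[R]_(n_ i))
    (r : forall i, 'rV[R]_(n_ i) -> R) (i : 'I_s) (y : 'rV[R]_(n_ i)) : \bar R :=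
  if `[< X i = setT >] then (r i y)%:E else indic_fun (X i) y.

Definition objective_hat (F : 'rV[R]_(\sum_i n_ i) -> R)
    (X : forall i, set 'rV[R]_(n_ i)) (r : forall i, 'rV[R]_(n_ i) -> R) x
    : \bar R :=
  ((F x)%:E + \sum_i r_hat X r (submxrow x i))%E.

End Blocks.

Section Probability.
Context {R : realType} {d : measure_display} {T : measurableType d}
  (P : probability T R).

(* Measurability for the Borel sigma-algebra of R^p, coordinatewise. *)
Definition random_vector p (V : T -> 'rV[R]_p) : Prop :=
  forall j, measurable_fun setT (fun w => V w 0 j).

(* [V] is a version of the conditional expectation of [U] given the
   sub-sigma-algebra [G]. *)
Definition is_cond_expectation (G : set (set T)) p (U V : T -> 'rV[R]_p) : Prop :=
  forall j,
    [/\ P.-integrable setT (fun w => (U w 0 j)%:E),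
        P.-integrable setT (fun w => (V w 0 j)%:E),
        (forall B : set R, measurable B -> G ((fun w => V w 0 j) @^-1` B)) &
        forall A, G A ->
          (\int[P]_(w in A) (V w 0 j)%:E = \int[P]_(w in A) (U w 0 j)%:E)%E].

End Probability.

(* Iterations are numbered from 0: [x 0] is the starting point x^1, and [x k],
   [Xi k], [alpha k] stand for x^{k+1}, Xi_{k+1}, alpha^{k+1}. *)
Section BSG.
Context {R : realType} {d dZ : measure_display}
  {T : measurableType d} {Z : measurableType dZ} (P : probability T R)
  {s : nat} {n_ : 'I_s -> nat}.
Notation E := 'rV[R]_(\sum_i n_ i).
Variables (f : E -> Z -> R) (xi0 : {RV P >-> Z}).
Variables (m : nat -> nat) (Xi : forall k, 'I_(m k) -> {RV P >-> Z}).
Arguments Xi : clear implicits.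

Definition expected_loss (x : E) : R := fine 'E_P[fun w => f x (xi0 w)]%E.

(* The sigma-algebra generated by the first [k] mini-batches Xi 0, .., Xi (k-1),
   trivial for [k = 0]. *)
Definition history (k : nat) : set (set T) :=
  <<s \bigcup_(j in [set j | (j < k)%N]) \bigcup_(l in [set: 'I_(m j)])
        preimage_set_system setT (Xi j l) measurable >>.

Definition point (x : nat -> T -> E) (k : nat) (i : 'I_s) (w : T) : E :=
  mix_blocks (x k.+1 w) (x k w) i.

Definition sgrad (x : nat -> T -> E) (k : nat) (i : 'I_s) (w : T)
    : 'rV[R]_(n_ i) :=
  (m k)%:R^-1 *: \sum_(l < m k) pgrad (f^~ (Xi k l w)) i (point x k i w).

Definition fgrad (x : nat -> T -> E) (k : nat) (i : 'I_s) (w : T)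
    : 'rV[R]_(n_ i) :=
  pgrad expected_loss i (point x k i w).

Definition grad_err (x : nat -> T -> E) (k : nat) (i : 'I_s) (w : T)
    : 'rV[R]_(n_ i) :=
  sgrad x k i w - fgrad x k i w.

Definition block_update (X : forall i, set 'rV[R]_(n_ i))
    (r : forall i, 'rV[R]_(n_ i) -> R) (alpha : nat -> 'I_s -> R)
    (x : nat -> T -> E) (k : nat) (i : 'I_s) (w : T) : Prop :=
  let xi := submxrow (x k w) i in
  let g := sgrad x k i w in
  (X i = setT ->
     argmin_on setT
       (fun y => dotv g (y - xi) + (2 * alpha k i)^-1 * enorm (y - xi) ^+ 2
                 + r i y)
       (submxrow (x k.+1 w) i))
  /\
  (X i <> setT ->
     exists2 v, limiting_subdiff (fun y => (r i y)%:E) xi v &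
     argmin_on (X i)
       (fun y => dotv (g + v) (y - xi)
                 + (2 * alpha k i)^-1 * enorm (y - xi) ^+ 2)
       (submxrow (x k.+1 w) i)).

(* [pdifferentiable] is what gives [sgrad] its meaning: ['D_v] is a total
   function in the library. *)
Definition bsg_sequence (X : forall i, set 'rV[R]_(n_ i))
    (r : forall i, 'rV[R]_(n_ i) -> R) (alpha : nat -> 'I_s -> R)
    (x1 : E) (x : nat -> T -> E) : Prop :=
  [/\ forall w, x 0%N w = x1,
      forall k, random_vector (x k),
      forall k i w l, pdifferentiable (f^~ (Xi k l w)) i (point x k i w) &
      forall k i w, block_update X r alpha x k i w].

End BSG.

(* Main.v *)
Require Import Defs.
From mathcomp Require Import measurable_realfun ring lra.

Set Implicit Arguments.
Unset Strict Implicit.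
Unset Printing Implicit Defensive.

Local Open Scope classical_set_scope.
Local Open Scope ring_scope.

(* Comparing the minimizer of each block subproblem with the previous iterate
   and absorbing <delta_i^k, x_i^{k+1} - x_i^k> by Young's inequality gives, for
   large k, the pathwise descent
     Phi(x^{k+1}) + a |x^{k+1} - x^k|^2 / beta_k
       <= Phi(x^k) + b beta_k sum_i |delta_i^k|^2.
   Put G_k = |x^{k+1} - x^k|^2 / beta_k^2 + sum_i |delta_i^k|^2.  Summing and
   taking expectations, sum_k beta_k E[G_k] < oo whereas sum_k beta_k = oo, so
   E[G_k] -> 0 along a subsequence.  The first-order conditions of the block
   subproblems exhibit an element of the subdifferential at x^{k+1} of squared
   norm at most C G_k, whence E dist <= e + C E[G_k] / e for every e > 0. *)

(** * Dot product and blocks *)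

Section DotProduct.
Context {R : realType} {p : nat}.
Implicit Types (u v w : 'rV[R]_p) (a b : R).

Lemma dotvC u v : dotv u v = dotv v u.
Proof. by apply: eq_bigr => j _; rewrite mulrC. Qed.

Lemma dotvDr u v w : dotv u (v + w) = dotv u v + dotv u w.
Proof. by rewrite -big_split; apply: eq_bigr => j _; rewrite !mxE mulrDr. Qed.

Lemma dotvZr a u v : dotv u (a *: v) = a * dotv u v.
Proof. by rewrite mulr_sumr; apply: eq_bigr => j _; rewrite !mxE mulrCA. Qed.

Lemma dotvNr u v : dotv u (- v) = - dotv u v.
Proof. by rewrite -scaleN1r dotvZr mulN1r. Qed.

Lemma dotvBr u v w : dotv u (v - w) = dotv u v - dotv u w.
Proof. by rewrite dotvDr dotvNr. Qed.

Lemma dotvDl u v w : dotv (u + v) w = dotv u w + dotv v w.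
Proof. by rewrite dotvC dotvDr 2!(dotvC w). Qed.

Lemma dotvZl a u v : dotv (a *: u) v = a * dotv u v.
Proof. by rewrite dotvC dotvZr dotvC. Qed.

Lemma dotvNl u v : dotv (- u) v = - dotv u v.
Proof. by rewrite dotvC dotvNr dotvC. Qed.

Lemma dotvBl u v w : dotv (u - v) w = dotv u w - dotv v w.
Proof. by rewrite dotvDl dotvNl. Qed.

Lemma dotv0l v : dotv 0 v = 0.
Proof. by rewrite -(scale0r 0) dotvZl mul0r. Qed.

Lemma dotvv_ge0 u : 0 <= dotv u u.
Proof. by apply: sumr_ge0 => j _; rewrite -expr2 sqr_ge0. Qed.

Lemma dotvv_eq0 u : dotv u u = 0 -> u = 0.
Proof.
move=> /eqP; rewrite psumr_eq0 => [/allP u0|j _]; last first.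
  by rewrite -expr2 sqr_ge0.
apply/rowP => j; rewrite mxE.
by have := u0 j (mem_index_enum j); rewrite /= mulf_eq0 orbb => /eqP.
Qed.

Lemma enorm_ge0 u : 0 <= enorm u. Proof. exact: sqrtr_ge0. Qed.

Lemma sqr_enorm u : enorm u ^+ 2 = dotv u u.
Proof. by rewrite sqr_sqrtr// dotvv_ge0. Qed.

Lemma dotvvN u : dotv (- u) (- u) = dotv u u.
Proof. by rewrite dotvNl dotvNr opprK. Qed.

Lemma dotv_young a u v : 0 < a ->
  dotv u v <= a / 2 * dotv u u + (2 * a)^-1 * dotv v v.
Proof.
move=> a0; have := dotvv_ge0 (a *: u - v).
rewrite dotvBl !dotvBr !dotvZl !dotvZr (dotvC v u) => H.
rewrite -subr_ge0 (_ : _ - _ = (2 * a)^-1 *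
  (a * (a * dotv u u) - a * dotv u v - (a * dotv u v - dotv v v))).
  by rewrite mulr_ge0// invr_ge0 mulr_ge0// ltW.
by field; rewrite lt0r_neq0.
Qed.

Lemma dotvvD_le u v : dotv (u + v) (u + v) <= 2 * dotv u u + 2 * dotv v v.
Proof.
have := dotvv_ge0 (u - v); rewrite !dotvBl !dotvBr !dotvDl !dotvDr (dotvC v u).
lra.
Qed.

Lemma dotvvD3_le u v w : dotv (u + v + w) (u + v + w) <=
  4 * dotv u u + 4 * dotv v v + 2 * dotv w w.
Proof. by have := dotvvD_le (u + v) w; have := dotvvD_le u v; lra. Qed.

Lemma near_dotvv (x : 'rV[R]_p) a : 0 < a ->
  \forall y \near x, dotv (y - x) (y - x) <= a.
Proof.
move=> a0.
(* Neighbourhoods are balls of the sup norm. Since [e <= 1], each squared coordinate is at most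
   [e * e <= a / (p + 1)], and there are [p] of them; [p + 1] rules out a zero divisor. *)
pose e := Num.min 1 (a / p.+1%:R).
have e0 : 0 < e by rewrite lt_min ltr01 divr_gt0.
near=> y.
have yxe : ball x e y by near: y; exact: nbhsx_ballx.
have yxj j : (y - x) 0 j * (y - x) 0 j <= a / p.+1%:R.
  have le_e : `|(y - x) 0 j| <= e.
    by rewrite !mxE distrC ltW//; exact: (yxe.2 0 j).
  rewrite -expr2 -real_normK ?num_real// expr2.
  apply: le_trans (ler_pM _ _ le_e le_e) _ => //.
  rewrite -[leRHS]mul1r; apply: ler_pM; rewrite ?(ltW e0)//.
    by rewrite ge_min lexx.
  by rewrite ge_min lexx orbT.
apply: le_trans (ler_sum _ (fun j _ => yxj j)) _.
rewrite sumr_const card_ord -[_ *+ p]mulr_natr mulrAC ler_pdivrMr//.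
by rewrite ler_wpM2l ?ler_nat// ltW.
Unshelve. all: by end_near. Qed.

End DotProduct.

(** * Block coordinates and partial gradients *)

Section Blocks.
Context {R : realType} {s : nat} {n_ : 'I_s -> nat}.
Implicit Types (x y d u v : 'rV[R]_(\sum_i n_ i)).
Implicit Types (F : 'rV[R]_(\sum_i n_ i) -> R).

Lemma dotv_blocks u v :
  dotv u v = \sum_i dotv (submxrow u i) (submxrow v i).
Proof.
rewrite [RHS]sig_big_dep/= (reindex _ tagnat.sig_bij_on)/=.
apply: eq_bigr => j _; rewrite !mxE.
by rewrite tagnat.sig2K.
Qed.

Lemma submxrow_set_block x i (y : 'rV[R]_(n_ i)) :
  submxrow (set_block x y) i = y.
Proof.
rewrite /set_block mxrowK; case: eqP => // e.
by rewrite (eq_irrelevance e erefl) castmx_id.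
Qed.

Lemma submxrow_set_block_neq x i (y : 'rV[R]_(n_ i)) j : j != i ->
  submxrow (set_block x y) j = submxrow x j.
Proof.
move=> ji; rewrite /set_block mxrowK.
by case: eqP ji => // ->; rewrite eqxx.
Qed.

Lemma submxrowZ a x i : submxrow (a *: x) i = a *: submxrow x i.
Proof. by apply/matrixP => k l; rewrite !mxE. Qed.

Lemma submxrow_set_block0 i (y : 'rV[R]_(n_ i)) j a :
  submxrow (a *: set_block 0 y) j = submxrow (set_block 0 (a *: y)) j.
Proof.
rewrite submxrowZ; have [->|ji] := eqVneq j i.
  by rewrite !submxrow_set_block.
by rewrite !submxrow_set_block_neq// submxrow0 scaler0.
Qed.

(** Moving one block along a line is moving the whole point along the zero-padded direction; this
    turns partial derivatives into directional ones. *)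
Lemma set_block_line x i (y : 'rV[R]_(n_ i)) a :
  set_block x (a *: y + submxrow x i) = a *: set_block 0 y + x.
Proof.
apply/mxrowP => j; rewrite submxrowD submxrow_set_block0.
have [->|ji] := eqVneq j i; first by rewrite !submxrow_set_block.
by rewrite !submxrow_set_block_neq// submxrow0 add0r.
Qed.

Lemma set_block_id x i : set_block x (submxrow x i) = x.
Proof.
apply/mxrowP => j; have [->|ji] := eqVneq j i.
  by rewrite submxrow_set_block.
by rewrite submxrow_set_block_neq.
Qed.

Lemma sum_set_block0 d :
  d = \sum_i \sum_j submxrow d i 0 j *: set_block 0 (delta_mx 0 j : 'rV_(n_ i)).
Proof.
apply/mxrowP => k; rewrite submxrow_sum (bigD1 k)//=.
rewrite [X in _ + X]big1 ?addr0 => [|i ik].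
  rewrite submxrow_sum [LHS]row_sum_delta; apply: eq_bigr => j _.
  by rewrite submxrowZ submxrow_set_block.
rewrite submxrow_sum big1// => j _.
by rewrite submxrowZ submxrow_set_block_neq 1?eq_sym// submxrow0 scaler0.
Qed.

(** By [set_block_line] both sides are limits of the same difference quotient. *)
Lemma pgradE F i x j :
  pgrad F i x 0 j = 'D_(set_block 0 (delta_mx 0 j : 'rV_(n_ i))) F x.
Proof.
rewrite mxE /derive set_block_id.
apply: (congr1 (fun g : R -> R => lim (g @ 0^'))); apply/funext => h /=.
by rewrite set_block_line.
Qed.

(** Expand [d] in the zero-padded basis vectors and use linearity of the differential. *)
Lemma diff_pgrad F x d : differentiable F x ->
  'd F x d = \sum_i dotv (pgrad F i x) (submxrow d i).
Proof.
move=> dF; rewrite {1}(sum_set_block0 d) linear_sum; apply: eq_bigr => i _.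
rewrite linear_sum; apply: eq_bigr => j _.
by rewrite linearZ/= pgradE deriveE// mulrC.
Qed.

End Blocks.

(** * Proximal subgradients *)

Section Subgradients.
Context {R : realType} {p : nat}.
Implicit Types (u v w x y z g : 'rV[R]_p) (a b C : R).

Lemma dotv_young_norm a u v : 0 < a ->
  `|dotv u v| <= a / 2 * dotv u u + (2 * a)^-1 * dotv v v.
Proof.
move=> a0; rewrite ler_norml dotv_young// andbT lerNl -dotvNl.
by rewrite -(dotvvN u) dotv_young.
Qed.

Lemma edist_to_ge0 u (A : set 'rV[R]_p) : (0 <= edist_to u A)%E.
Proof.
by apply: le_ereal_inf_tmp => _ [y _ <-]; rewrite lee_fin enorm_ge0.
Qed.

Lemma dotvv_le_enorm q C u (v : 'rV[R]_q) :
  enorm u <= C * enorm v -> dotv u u <= C ^+ 2 * dotv v v.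
Proof.
move=> uv; rewrite -!sqr_enorm -exprMn ler_pXn2r// nnegrE ?enorm_ge0//.
exact: le_trans (enorm_ge0 _) uv.
Qed.

Lemma enormZ a u : enorm (a *: u) = `|a| * enorm u.
Proof.
by rewrite /enorm dotvZl dotvZr mulrA -expr2 sqrtrM ?sqr_ge0// sqrtr_sqr.
Qed.

(** The bound is affine in the squared norm, so a bound on the expected square passes directly to
    the expected norm. *)
Lemma enorm_le_young u e : 0 < e -> enorm u <= e + dotv u u / e.
Proof.
move=> e0; rewrite -sqr_enorm -(ler_pM2r e0) mulrDl divfK ?lt0r_neq0//.
by have := sqr_ge0 (enorm u - e); have := sqr_ge0 (enorm u + e); nra.
Qed.

Lemma near_dotvv_le_enorm x C e : 0 < e ->
  \forall y \near x, C * dotv (y - x) (y - x) <= e * enorm (y - x).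
Proof.
move=> e0; have C0 : 0 < `|C| + 1 by rewrite ltr_wpDl.
near=> y.
have : dotv (y - x) (y - x) <= (e / (`|C| + 1)) ^+ 2.
  by near: y; apply: near_dotvv; rewrite exprn_gt0// divr_gt0.
have D0 : 0 <= e / (`|C| + 1) by rewrite divr_ge0 ?(ltW e0) ?(ltW C0).
rewrite -sqr_enorm ler_pXn2r ?nnegrE ?enorm_ge0//.
rewrite ler_pdivlMr// => Hle; rewrite expr2 mulrA ler_wpM2r ?enorm_ge0//.
have := enorm_ge0 (y - x); have := ler_norm C; nra.
Unshelve. all: by end_near. Qed.

(** A proximal subgradient is regular, because the quadratic term is [o(|y - x|)]; constant
    sequences then make it a limiting one. *)
Lemma prox_limiting_subdiff (h : 'rV[R]_p -> \bar R) C x v :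
  h x \is a fin_num ->
  (forall y, h x + (dotv v (y - x) - C * dotv (y - x) (y - x))%:E <= h y)%E ->
  limiting_subdiff h x v.
Proof.
move=> hx hy; split => //; exists (cst x), (cst v); split => //.
- exact: cvg_cst.
- exact: (@cvg_cst _ (h x)).
- move=> t; rewrite /cst; split => // e e0; near=> y.
  apply: le_trans (hy y); rewrite leeD2l// lee_fin lerB//.
  by near: y; exact: near_dotvv_le_enorm.
- exact: cvg_cst.
Unshelve. all: by end_near. Qed.

(** Testing the regular subgradient inequality along the direction of the subgradient itself gives
    norm at most [e] for every [e > 0], so all approximating subgradients vanish. *)
Lemma limiting_subdiff0 x v :
  limiting_subdiff (fun=> 0%E) x v -> v = 0.
Proof.
move=> [_ [xs [vs [_ _ vsP /cvg_lim <-//]]]].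
suff -> : vs = cst 0 by apply: cvg_lim => //; exact: cvg_cst.
apply/funext => t; have [_ reg] := vsP t; apply: dotvv_eq0.
suff v0 : enorm (vs t) = 0 by rewrite -sqr_enorm v0 expr0n.
apply/eqP; rewrite eq_le enorm_ge0 andbT.
apply/ler_addgt0Pl => e e0; rewrite addr0.
have /nbhs_ballP[d /= d0 xd] := reg e e0.
have v1 : 0 < `|vs t| + 1 by rewrite ltr_wpDl.
(* This step length keeps the test point [h *: vs t + xs t] inside the ball of radius [d]. *)
pose h := d / (`|vs t| + 1); have h0 : 0 < h by rewrite divr_gt0.
have /xd : ball (xs t) d (h *: vs t + xs t).
  rewrite -ball_normE /= opprD addrCA subrr addr0 normrN normrZ gtr0_norm//.
  by rewrite mulrAC ltr_pdivrMr// ltr_pM2l// ltrDl.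
rewrite /= add0e addrK lee_fin dotvZr enormZ gtr0_norm// -sqr_enorm subr_le0.
rewrite [e * _]mulrCA ler_pM2l// expr2; have := enorm_ge0 (vs t).
by rewrite le_eqVlt => /predU1P[<- _|v0]; [exact: ltW|rewrite ler_pM2r].
Qed.

(** Both first-order conditions below come from this expansion: [t = 1] for the proximal step, small
    [t] for the constrained one. *)
Lemma dotv_quadratic_line g b u e t :
  dotv g (t *: u + e) + b * dotv (t *: u + e) (t *: u + e) =
  dotv g e + b * dotv e e
    + t * (dotv (g + (2 * b) *: e) u + b * t * dotv u u).
Proof.
by rewrite !dotvDl !dotvDr !dotvZl !dotvZr (dotvC u e); ring.
Qed.

(** Expanding the quadratic model exactly around [z] turns minimality into a global proximal
    subgradient inequality for [r], with curvature [b]. *)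
Lemma argmin_prox_subgrad (r : 'rV[R]_p -> R) g x b z :
  argmin_on setT (fun y => dotv g (y - x) + b * enorm (y - x) ^+ 2 + r y) z ->
  forall y, r z + (dotv (- (g + (2 * b) *: (z - x))) (y - z)
                   - b * dotv (y - z) (y - z)) <= r y.
Proof.
move=> [_ zmin] y; have := zmin y I; rewrite !sqr_enorm.
have -> : y - x = 1 *: (y - z) + (z - x) by rewrite scale1r subrKA.
by rewrite dotv_quadratic_line dotvNl; lra.
Qed.

Lemma convex_segment (X : set 'rV[R]_p) z y t :
  @convex_set R 'rV[R]_p X -> X z -> X y -> 0 <= t -> t <= 1 ->
  X (t *: (y - z) + z).
Proof.
move=> Xc zX yX t0 t1.
have := Xc y z (Itv01 t0 t1); rewrite !inE => /(_ yX zX).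
congr X; rewrite /conv /= scalerBl scale1r scalerBr.
by rewrite addrA addrAC.
Qed.

(** If the model had negative slope from [z] towards some [y] in [X], a short move along the
    segment, which stays in [X] by convexity, would lower its value. *)
Lemma argmin_normal (X : set 'rV[R]_p) g x b z : 0 <= b ->
  @convex_set R 'rV[R]_p X ->
  argmin_on X (fun y => dotv g (y - x) + b * enorm (y - x) ^+ 2) z ->
  forall y, X y -> dotv (- (g + (2 * b) *: (z - x))) (y - z) <= 0.
Proof.
move=> b0 Xc [zX zmin] y yX; rewrite dotvNl oppr_le0 leNgt; apply/negP.
set G := dotv _ _ => G0; pose q := dotv (y - z) (y - z).
have q0 : 0 <= q := dotvv_ge0 _.
have D0 : 0 < b * q + 1 - G.
  by have := mulr_ge0 b0 q0; lra.
(* This [t] lies in [(0, 1]] and gives [G + b t q = - t (1 - G) < 0], against minimality of [z]. *)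
pose t := - G / (b * q + 1 - G).
have t0 : 0 < t by rewrite divr_gt0// oppr_gt0.
have t1 : t <= 1 by rewrite ler_pdivrMr// mul1r; have := mulr_ge0 b0 q0; lra.
have := zmin _ (convex_segment Xc zX yX (ltW t0) t1).
rewrite !sqr_enorm.
have -> : t *: (y - z) + z - x = t *: (y - z) + (z - x) by rewrite addrA.
rewrite dotv_quadratic_line -/G -/q lerDl pmulr_rge0//.
have tE : t * (b * q + 1 - G) = - G by rewrite divfK ?lt0r_neq0.
by have := mulr_ge0 b0 q0; nra.
Qed.

End Subgradients.

(** * Quadratic bounds on the objective *)

Section SmoothObjective.
Context {R : realType} {s : nat} {n_ : 'I_s -> nat}.
Implicit Types (x y z d u v : 'rV[R]_(\sum_i n_ i)).

Lemma dotvv_block_le d i : dotv (submxrow d i) (submxrow d i) <= dotv d d.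
Proof.
rewrite (dotv_blocks d) (bigD1 i)//= lerDl.
by apply: sumr_ge0 => j _; exact: dotvv_ge0.
Qed.

Lemma is_derive_line (F : 'rV[R]_(\sum_i n_ i) -> R) x d (t : R) :
  differentiable F (t *: d + x) ->
  is_derive t 1 (fun t => F (t *: d + x)) ('d F (t *: d + x) d).
Proof.
move=> dF.
have E : (fun h : R => h^-1 *: (((fun t => F (t *: d + x)) \o shift t) (h *: (1 : R))
    - F (t *: d + x))) =
  (fun h : R => h^-1 *: ((F \o shift (t *: d + x)) (h *: d) - F (t *: d + x))).
  apply/funext => h /=.
  by rewrite -[h *: 1]/(h * 1) mulr1 scalerDl addrA.
split; first by rewrite /derivable E; exact: diff_derivable.
by rewrite /derive E -deriveE.
Qed.

(** Mean value theorem on the segment, then the Lipschitz bound in each of the [s] blocks. The upper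
    side serves the descent, the lower side the subdifferential. *)
Lemma pgrad_quadratic_bound (F : 'rV[R]_(\sum_i n_ i) -> R) (L : R) x d :
  (forall y, differentiable F y) -> 0 < L ->
  (forall y z i, enorm (pgrad F i y - pgrad F i z) <= L * enorm (y - z)) ->
  `|F (d + x) - F x - \sum_i dotv (pgrad F i x) (submxrow d i)|
    <= s%:R * L * dotv d d.
Proof.
move=> dF L0 FL.
have /MVT_segment : (0 : R) <= 1 by [].
move=> /(_ (fun t => F (t *: d + x)) (fun t => 'd F (t *: d + x) d)).
have dL (t : R) : is_derive t 1 (fun t => F (t *: d + x)) ('d F (t *: d + x) d).
  exact: is_derive_line.
case=> //.
  apply: derivable_within_continuous => t _; exact: ex_derive.
move=> t; rewrite in_itv /= => /andP[t0 t1].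
rewrite scale1r scale0r add0r subr0 mulr1 => ->.
rewrite diff_pgrad// -sumrB (le_trans (ler_norm_sum _ _ _))//.
have <- : \sum_(i < s) (L * dotv d d) = s%:R * L * dotv d d.
  by rewrite sumr_const card_ord -mulrA mulr_natl.
apply: ler_sum => i _; rewrite -dotvBl.
(* Young's inequality with weight [1 / L] balances the two halves: each is at most
   [L / 2 * dotv d d]. *)
have Li : 0 < L^-1 by rewrite invr_gt0.
apply: le_trans (dotv_young_norm _ _ Li) _.
have := dotvv_le_enorm (FL (t *: d + x) x i); rewrite addrK dotvZl dotvZr.
set q := dotv (_ - _) _ => qL; have := dotvv_block_le d i.
set p := dotv (submxrow _ _) _ => pd; have dd := dotvv_ge0 d.
have tt : t * (t * dotv d d) <= dotv d d.
  by rewrite mulrA -[leRHS]mul1r ler_wpM2r// mulr_ile1.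
have L2 : 0 <= L / 2 by rewrite divr_ge0// ltW.
have qd : L^-1 / 2 * q <= L / 2 * dotv d d.
  have Li2 : 0 <= L^-1 / 2 by rewrite divr_ge0// ltW.
  apply: le_trans (ler_wpM2l Li2 qL) _.
  rewrite (_ : L^-1 / 2 * _ = L / 2 * (t * (t * dotv d d))).
    by rewrite ler_wpM2l.
  by field; rewrite lt0r_neq0.
have {}pd : (2 * L^-1)^-1 * p <= L / 2 * dotv d d.
  by rewrite invfM invrK (mulrC 2^-1) ler_wpM2l.
lra.
Qed.

(** Quadratic growth lets the second moment bound on the iterates control the expected objective
    value at the index where the summation starts. *)
Lemma objective_quadratic_bound (F : 'rV[R]_(\sum_i n_ i) -> R)
    (r : forall i, 'rV[R]_(n_ i) -> R) (L : R) (Lr : 'I_s -> R) :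
  (forall y, differentiable F y) -> 0 < L ->
  (forall y z i, enorm (pgrad F i y - pgrad F i z) <= L * enorm (y - z)) ->
  (forall i (y z : 'rV_(n_ i)), `|r i y - r i z| <= Lr i * enorm (y - z)) ->
  exists2 H : R, 0 <= H & forall x, objective F r x <= H * (1 + dotv x x).
Proof.
move=> dF L0 FL rL.
have [H0 [H1 [HF Hr]]] : exists H0 : R, exists H1 : 'I_s -> R, 
  (forall x, F x <= H0 + (s%:R * L + 1) * dotv x x) /\
  (forall i (y : 'rV_(n_ i)), r i y <= H1 i + dotv y y).
  exists (F 0 + \sum_i dotv (pgrad F i 0) (pgrad F i 0)).
  exists (fun i => r i 0 + (Lr i) ^+ 2); split.
    move=> x; have := pgrad_quadratic_bound 0 x dF L0 FL; rewrite addr0.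
    rewrite ler_norml => /andP[_].
    have : \sum_i dotv (pgrad F i 0) (submxrow x i) <=
           \sum_i dotv (pgrad F i 0) (pgrad F i 0) + dotv x x.
      rewrite (dotv_blocks x) -big_split; apply: ler_sum => i _ /=.
      have := dotv_young (pgrad F i 0) (submxrow x i) ltr01.
      have := dotvv_ge0 (pgrad F i 0); have := dotvv_ge0 (submxrow x i).
      lra.
    lra.
  move=> i y; have := rL i y 0; rewrite subr0 ler_norml => /andP[_].
  by rewrite -sqr_enorm; nra.
pose c := H0 + \sum_i H1 i.
exists (`|c| + s%:R * L + 2) => [|x].
  by rewrite !addr_ge0// mulr_ge0// ltW.
have : objective F r x <= c + (s%:R * L + 2) * dotv x x.
  rewrite /objective (le_trans (lerD (HF x) (ler_sum _ (fun i _ => Hr i _))))//.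
  rewrite big_split /= -dotv_blocks /c; lra.
have := ler_norm c; have := normr_ge0 c; have := dotvv_ge0 x.
have : 0 <= s%:R * L by rewrite mulr_ge0// ltW.
nra.
Qed.

End SmoothObjective.

(** * Subgradients of the extended objective *)

Section ObjectiveHat.
Context {R : realType} {s : nat} {n_ : 'I_s -> nat}.
Variables (F : 'rV[R]_(\sum_i n_ i) -> R).
Variables (X : forall i, set 'rV[R]_(n_ i)) (r : forall i, 'rV[R]_(n_ i) -> R).
Arguments r : clear implicits.

(** Quadratic minorants add up over [F] and the blocks, so the sum has a proximal subgradient with
    curvature [K + C]; no subdifferential sum rule is invoked. *)
Lemma objective_hat_subdiff (K C : R) x (v : forall i, 'rV[R]_(n_ i)) :
  (forall d, `|F (d + x) - F x - \sum_i dotv (pgrad F i x) (submxrow d i)|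
               <= K * dotv d d) ->
  (forall i, r_hat X r (submxrow x i) \is a fin_num) ->
  (forall i y, r_hat X r (submxrow x i) +
     (dotv (v i) (y - submxrow x i)
      - C * dotv (y - submxrow x i) (y - submxrow x i))%:E <= r_hat X r y)%E ->
  limiting_subdiff (objective_hat F X r) x (\mxrow_i (pgrad F i x + v i)).
Proof.
move=> FK rfin rC; apply: (@prox_limiting_subdiff _ _ _ (K + C)).
  rewrite /objective_hat fin_numD/= /=; apply/sum_fin_numP => i _ _.
  exact: rfin.
move=> y; rewrite /objective_hat.
have := FK (y - x); rewrite subrK ler_norml => /andP[Fy _].
have {}Fy : F x + (\sum_i dotv (pgrad F i x) (submxrow (y - x) i)
    - K * dotv (y - x) (y - x)) <= F y by lra.
have ry : (\sum_i r_hat X r (submxrow x i) +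
    (\sum_i (dotv (v i) (submxrow (y - x) i)
      - C * dotv (submxrow (y - x) i) (submxrow (y - x) i)))%:E
    <= \sum_i r_hat X r (submxrow y i))%E.
  rewrite -sumEFin -big_split/=; apply: lee_sum => i _.
  by rewrite submxrowB; exact: rC.
rewrite -lee_fin in Fy; apply: le_trans (leeD Fy ry).
rewrite [in leRHS]EFinD addeACA -EFinD leeD2l// lee_fin.
rewrite sumrB -mulr_sumr -dotv_blocks.
have -> : dotv (\mxrow_i (pgrad F i x + v i)) (y - x) =
    \sum_i dotv (pgrad F i x) (submxrow (y - x) i)
    + \sum_i dotv (v i) (submxrow (y - x) i).
  rewrite dotv_blocks -big_split; apply: eq_bigr => i _.
  by rewrite mxrowK dotvDl.
lra.
Qed.

End ObjectiveHat.

(** * One iteration of the method *)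

Section Step.
Context {R : realType} {s : nat} {n_ : 'I_s -> nat}.
Notation E := 'rV[R]_(\sum_i n_ i).
Variables (F : E -> R) (L : R).
Variables (X : forall i, set 'rV[R]_(n_ i)) (r : forall i, 'rV[R]_(n_ i) -> R).
Arguments r : clear implicits.
Arguments X : clear implicits.
Hypothesis F_diff : forall y, differentiable F y.
Hypothesis L_gt0 : 0 < L.
Hypothesis F_Lip : forall y z i,
  enorm (pgrad F i y - pgrad F i z) <= L * enorm (y - z).
Hypothesis X_convex : forall i, @convex_set R 'rV[R]_(n_ i) (X i).
Hypothesis X_or_r : forall i, X i = setT \/ forall y, r i y = 0.

(** For one sample, [x] and [z] are consecutive iterates, [g] the stochastic block gradients and [a]
    the stepsizes. The minimization below covers both kinds of update. *)
Variables (x z : E) (g : forall i, 'rV[R]_(n_ i)) (a : 'I_s -> R).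
Hypothesis a_gt0 : forall i, 0 < a i.
Hypothesis z_argmin : forall i,
  argmin_on (X i)
    (fun y => dotv (g i) (y - submxrow x i)
      + (2 * a i)^-1 * enorm (y - submxrow x i) ^+ 2 + r i y)
    (submxrow z i).

Let step i := submxrow (z - x) i.
(** Block [i] of the subgradient of [objective_hat] at [z]. *)
Let residual i := pgrad F i z - (g i + (a i)^-1 *: step i).
Let err i := g i - pgrad F i (mix_blocks z x i).

(** Each block of the mixed point agrees with that of [x] or of [z]. *)
Lemma dotvv_sub_mix_blocks i :
  dotv (x - mix_blocks z x i) (x - mix_blocks z x i) <= dotv (z - x) (z - x) /\
  dotv (z - mix_blocks z x i) (z - mix_blocks z x i) <= dotv (z - x) (z - x).
Proof.
split; rewrite !(dotv_blocks _ (_ - _)); apply: ler_sum => j _;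
  rewrite !submxrowB mxrowK; case: ifP => _;
  rewrite ?subrr ?dotv0l ?dotvv_ge0//.
by rewrite -opprB dotvvN.
Qed.

Lemma dotvv_pgrad_le y u C i : dotv (y - u) (y - u) <= C ->
  dotv (pgrad F i y - pgrad F i u) (pgrad F i y - pgrad F i u) <= L ^+ 2 * C.
Proof.
move=> yu; apply: le_trans (dotvv_le_enorm (F_Lip _ _ _)) _.
by rewrite ler_wpM2l// sqr_ge0.
Qed.

(** On an unconstrained block this is optimality of the proximal step. Otherwise [r i] vanishes, the
    vector is normal to the convex set [X i], and the quadratic term is mere slack. *)
Lemma r_hat_prox_subgrad i :
  r_hat X r (submxrow z i) \is a fin_num /\
  forall y, (r_hat X r (submxrow z i) +
    (dotv (- (g i + (a i)^-1 *: step i)) (y - submxrow z i)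
     - (2 * a i)^-1 * dotv (y - submxrow z i) (y - submxrow z i))%:E
    <= r_hat X r y)%E.
Proof.
have a2 : (a i)^-1 = 2 * (2 * a i)^-1 by field; rewrite lt0r_neq0.
have a20 : 0 <= (2 * a i)^-1 by rewrite invr_ge0 mulr_ge0// ltW.
rewrite /step submxrowB a2; have zmin := z_argmin i.
rewrite /r_hat; case: asboolP => [XT|XnT].
  split => // y; rewrite -EFinD lee_fin.
  by rewrite XT in zmin; exact: argmin_prox_subgrad zmin y.
have r0 y : r i y = 0 by case: (X_or_r i).
have [zX _] := zmin.
rewrite /indic_fun asboolT//; split => // y; rewrite add0e.
case: asboolP => yX; last by rewrite leey.
rewrite lee_fin subr_le0 (@le_trans _ _ 0) ?mulr_ge0 ?dotvv_ge0//.
apply: (argmin_normal a20 (@X_convex i)) yX.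
by split => // u uX; have := zmin.2 u uX; rewrite !r0 !addr0.
Qed.

(** The residual splits into gradient drift from the mixed point to [z], stochastic error, and
    scaled step. *)
Lemma dotvv_pgrad_z_le i :
  dotv (residual i) (residual i) <= 4 * L ^+ 2 * dotv (z - x) (z - x)
    + 4 * dotv (err i) (err i) + 2 * ((a i)^-1) ^+ 2 * dotv (step i) (step i).
Proof.
have -> : residual i = (pgrad F i z - pgrad F i (mix_blocks z x i)) + - err i
               + - ((a i)^-1 *: step i).
  by rewrite /residual /err opprD opprB addrA addrA subrK.
apply: le_trans (dotvvD3_le _ _ _) _; rewrite !dotvvN dotvZl dotvZr.
have := dotvv_pgrad_le i (dotvv_sub_mix_blocks i).2.
lra.
Qed.

(** The minimizer is compared with the old block, a feasible competitor; the gradient at [x] is then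
    replaced by [g i] at the cost of the error and of the drift between [x] and the mixed point. *)
Lemma block_descent i : X i (submxrow x i) ->
  dotv (pgrad F i x) (step i) + r i (submxrow z i) <=
  r i (submxrow x i) + a i * dotv (err i) (err i)
    - (4 * a i)^-1 * dotv (step i) (step i) + L * dotv (z - x) (z - x).
Proof.
move=> xX; have [_ /(_ _ xX)] := z_argmin i.
rewrite subrr !sqr_enorm (dotvC _ 0) !dotv0l mulr0 !add0r -submxrowB -/(step i).
(* With weight [2 * a i], the error term consumes half of the proximal term [(2 a_i)^-1 |step|^2];
   the other half survives. *)
have a2 : 0 < 2 * a i by rewrite mulr_gt0.
have := dotv_young (- err i) (step i) a2.
rewrite dotvvN dotvNl {1}/err dotvBl.
have Li : 0 < L^-1 by rewrite invr_gt0.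
have := dotv_young (pgrad F i x - pgrad F i (mix_blocks z x i)) (step i) Li.
rewrite dotvBl.
have := dotvv_pgrad_le i (dotvv_sub_mix_blocks i).1.
set q := dotv (_ - _) (_ - _); set p := dotv (z - x) _.
set u := dotv (step i) _; set t := dotv (err i) _ => qp.
have -> : (2 * L^-1)^-1 = L / 2 by field; rewrite lt0r_neq0.
have L1q : L^-1 / 2 * q <= L / 2 * p.
  have Li2 : 0 <= L^-1 / 2 by rewrite divr_ge0// ltW.
  apply: le_trans (ler_wpM2l Li2 qp) _.
  by rewrite le_eqVlt; apply/orP; left; apply/eqP; field; rewrite lt0r_neq0.
have -> : (2 * (2 * a i))^-1 = (4 * a i)^-1 by congr (_^-1); ring.
have -> : (2 * a i)^-1 = (4 * a i)^-1 + (4 * a i)^-1 by field; rewrite lt0r_neq0.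
have -> : 2 * a i / 2 = a i by field.
have : L / 2 * u <= L / 2 * p.
  by rewrite ler_wpM2l ?dotvv_block_le// divr_ge0// ltW.
lra.
Qed.

(** Here [b] stands for [beta k], [b0] for an upper bound on it, and [D] bounds the ratios of
    stepsize to [b] and their inverses. *)
Variables (D b b0 : R).
Hypothesis D_gt0 : 0 < D.
Hypothesis b_gt0 : 0 < b.
Hypothesis a_le : forall i, a i <= D * b.
Hypothesis a_ge : forall i, (a i)^-1 <= D / b.

(* Up to a constant, [gap] bounds the squared distance from 0 to the
   subdifferential at [z]. *)
Definition gap := (b ^- 2) * dotv (z - x) (z - x) + \sum_i dotv (err i) (err i).

(** Sum [block_descent] over the blocks, add the quadratic upper bound on [F], and scale by
    [8 * D]. *)
Lemma descent : (forall i, X i (submxrow x i)) -> 16 * (s%:R * L) * D * b <= 1 ->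
  b * gap <= 8 * D * (objective F r x - objective F r z)
     + (8 * D ^+ 2 + 1) * (b * \sum_i dotv (err i) (err i)).
Proof.
move=> xX Kb.
have p0 := dotvv_ge0 (z - x); set p := dotv _ _ in p0.
have stepE : \sum_i dotv (step i) (step i) = p by rewrite /p dotv_blocks.
have FK : F z - F x - \sum_i dotv (pgrad F i x) (step i) <= s%:R * L * p.
  have := pgrad_quadratic_bound x (z - x) F_diff L_gt0 F_Lip.
  by rewrite subrK ler_norml => /andP[].
have : \sum_i (dotv (pgrad F i x) (step i) + r i (submxrow z i)) <=
    \sum_i (r i (submxrow x i) + a i * dotv (err i) (err i)
      - (4 * a i)^-1 * dotv (step i) (step i) + L * p).
  by apply: ler_sum => i _; exact: block_descent.
rewrite !big_split/= sumrN sumr_const card_ord -[_ *+ s]mulr_natl.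
rewrite /gap /objective -/p; set e := \sum_i dotv (err i) _.
have : \sum_i a i * dotv (err i) (err i) <= D * b * e.
  by rewrite mulr_sumr ler_sum// => i _; rewrite ler_wpM2r ?dotvv_ge0.
have : (4 * (D * b))^-1 * p <= \sum_i (4 * a i)^-1 * dotv (step i) (step i).
  rewrite -stepE mulr_sumr ler_sum// => i _.
  rewrite ler_wpM2r ?dotvv_ge0// lef_pV2 ?posrE ?mulr_gt0//.
  by rewrite ler_wpM2l.
(* [P] is [b] times the first term of [gap]. *)
have [P0 pE] : 0 <= p / b /\ p = p / b * b.
  by rewrite divr_ge0 ?(ltW b_gt0)// divfK ?lt0r_neq0.
set P := p / b in P0 pE.
have -> : (4 * (D * b))^-1 * p = P / (4 * D).
  by rewrite pE; field; rewrite !lt0r_neq0.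
have -> : b * (b ^- 2 * p + e) = P + b * e.
  by rewrite pE; field; rewrite lt0r_neq0.
(* After scaling, the step terms contribute [2 * P], and smallness of [b] makes the curvature errors
   [2 s L p] cost at most [P]. *)
have : 16 * (s%:R * L) * D * b * P <= P by rewrite ler_piMl.
set U := \sum_i (4 * a i)^-1 * _; set A := \sum_i a i * _.
set Rx := \sum_i r i _; set Rz := \sum_i r i _; set S := \sum_i dotv _ _.
move=> KP HU HA HS.
have PE : 8 * D * (P / (4 * D)) = 2 * P by field; rewrite lt0r_neq0.
have : 8 * D * (F z + Rz) <= 8 * D * (F x + Rx + D * b * e - P / (4 * D)
    + 2 * (s%:R * L * p)).
  rewrite ler_pM2l ?mulr_gt0//; move: FK; rewrite -/S; lra.
rewrite !mulrDr mulrN PE pE.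
have -> : 8 * D * (2 * (s%:R * L * (P * b))) = 16 * (s%:R * L) * D * b * P by ring.
nra.
Qed.

(** The residuals form a subgradient whose squared norm is at most a constant times [gap]; [b0]
    makes that constant uniform over the iterations. *)
Lemma edist_to_subdiff_le e : 0 < e -> b <= b0 ->
  (edist_to 0 (limiting_subdiff (objective_hat F X r) z) <=
   (e + (4 * s%:R * L ^+ 2 * b0 ^+ 2 + 2 * D ^+ 2 + 4) * gap / e)%:E)%E.
Proof.
move=> e0 bb0.
(* The sum dominates the curvature of every block; its size does not enter the final bound. *)
pose C := \sum_i (2 * a i)^-1.
pose v i := - (g i + (a i)^-1 *: step i).
have vs : limiting_subdiff (objective_hat F X r) z
    (\mxrow_i (pgrad F i z + v i)).
  apply: (@objective_hat_subdiff _ _ _ _ _ _ (s%:R * L) C).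
  - by move=> d; exact: pgrad_quadratic_bound.
  - by move=> i; have [] := r_hat_prox_subgrad i.
  - move=> i y; have [_ /(_ y)] := r_hat_prox_subgrad i.
    apply: le_trans; rewrite leeD2l// lee_fin lerB// ler_wpM2r ?dotvv_ge0//.
    rewrite /C (bigD1 i)//= lerDl sumr_ge0// => j _.
    by rewrite invr_ge0 mulr_ge0// ltW.
apply: (@le_trans _ _ (enorm (\mxrow_i (pgrad F i z + v i)))%:E).
  by apply: ereal_inf_lbound; exists (\mxrow_i (pgrad F i z + v i)); rewrite ?subr0.
rewrite lee_fin (le_trans (enorm_le_young _ e0))// lerD2l
  ler_wpM2r ?invr_ge0 ?(ltW e0)//.
have p0 := dotvv_ge0 (z - x); rewrite /gap; set p := dotv (z - x) _ in p0 *.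
set er := \sum_i dotv (err i) _.
have er0 : 0 <= er by apply: sumr_ge0 => i _; exact: dotvv_ge0.
apply: (@le_trans _ _ (\sum_i (4 * L ^+ 2 * p + 4 * dotv (err i) (err i)
    + 2 * (D / b) ^+ 2 * dotv (step i) (step i)))).
  rewrite dotv_blocks; apply: ler_sum => i _; rewrite mxrowK.
  apply: le_trans (dotvv_pgrad_z_le i) _.
  rewrite lerD2l ler_wpM2r ?dotvv_ge0// ler_wpM2l//.
  by rewrite ler_pXn2r// nnegrE ?invr_ge0 ?divr_ge0
    ?(ltW (a_gt0 i)) ?(ltW D_gt0) ?(ltW b_gt0).
have stepE : \sum_i dotv (step i) (step i) = p by rewrite /p dotv_blocks.
rewrite !big_split/= -!mulr_sumr -/er stepE sumr_const card_ord -[_ *+ s]mulr_natl.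
have [P0 pE] : 0 <= b ^- 2 * p /\ p = b ^+ 2 * (b ^- 2 * p).
  rewrite mulr_ge0 ?invr_ge0 ?exprn_ge0 ?(ltW b_gt0)//.
  by rewrite mulrA divff ?mul1r// expf_neq0// lt0r_neq0.
set P := b ^- 2 * p in P0 pE *.
have -> : 2 * (D / b) ^+ 2 * p = 2 * D ^+ 2 * P.
  by rewrite pE; field; rewrite lt0r_neq0.
have bb : b ^+ 2 <= b0 ^+ 2.
  by rewrite ler_pXn2r// nnegrE ?(ltW b_gt0)// (le_trans (ltW b_gt0)).
have sL0 : 0 <= 4 * s%:R * L ^+ 2 by rewrite mulr_ge0 ?sqr_ge0// mulr_ge0.
have -> : 4 * L ^+ 2 * (s%:R * p) = 4 * s%:R * L ^+ 2 * (b ^+ 2 * P).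
  by rewrite pE; ring.
have : 4 * s%:R * L ^+ 2 * (b ^+ 2 * P) <= 4 * s%:R * L ^+ 2 * b0 ^+ 2 * P.
  by rewrite -[leRHS]mulrA ler_wpM2l// ler_wpM2r.
have : 0 <= (4 * s%:R * L ^+ 2 * b0 ^+ 2 + 2 * D ^+ 2) * er.
  by rewrite mulr_ge0// addr_ge0// mulr_ge0// sqr_ge0.
rewrite !mulrDl; lra.
Qed.

End Step.

(** * Divergent series and integrals *)

Section Sequences.
Context {R : realType}.

(** If [u] stayed above [e] from [n] on, the tail sums of the weights would be at most [M / e],
    against divergence. *)
Lemma divergent_weights_small (b : nat -> R) (u : nat -> \bar R) (M : R) k0 :
  (forall k, 0 < b k) -> (\sum_(0 <= k <oo) (b k)%:E = +oo)%E ->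
  (forall k, 0 <= u k)%E ->
  (forall N, \sum_(k0 <= k < N) (b k)%:E * u k <= M%:E)%E ->
  forall (e : R) n, 0 < e -> exists2 k, (n <= k)%N & (u k < e%:E)%E.
Proof.
move=> b0 bsum u0 uM e n e0; apply: contrapT => nex.
have H k : (n <= k)%N -> (e%:E <= u k)%E.
  by move=> nk; rewrite leNgt; apply/negP => uk; apply: nex; exists k.
pose n' := maxn n k0.
have bE k : (0 <= (b k)%:E)%E by rewrite lee_fin ltW.
suff : (\sum_(0 <= k <oo) (b k)%:E < +oo)%E by rewrite bsum ltxx.
rewrite (@nneseries_split _ _ 0 n')// add0n; apply: lte_add_pinfty.
  by rewrite sumEFin ltry.
apply: (@le_lt_trans _ _ (M / e)%:E); last by rewrite ltry.
apply: lime_le; first by apply: is_cvg_nneseries.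
apply: nearW => N.
have [Nn|nN] := leqP N n'.
  (* The hypothesis at the empty sum [N = k0] gives [0 <= M]. *)
  rewrite big_geq// lee_fin divr_ge0 ?(ltW e0)//.
  by have := uM k0; rewrite big_geq// lee_fin.
rewrite sumEFin lee_fin ler_pdivlMr// mulrC mulr_sumr -lee_fin -sumEFin.
apply: le_trans (uM N).
rewrite [leRHS](@big_cat_nat _ _ _ n')//=; last 2 first.
  by rewrite leq_maxr.
  exact: ltnW.
rewrite -[leLHS]add0e; apply: leeD.
  by apply: sume_ge0 => k _; rewrite mule_ge0.
rewrite big_nat_cond [leRHS]big_nat_cond.
apply: lee_sum => k /andP[/andP[nk _] _].
rewrite EFinM muleC lee_pmul2l// ?lte_fin// H// (leq_trans _ nk)//.
by rewrite leq_maxl.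
Qed.

Lemma increasing_choice (Q : nat -> nat -> Prop) :
  (forall t n, exists2 k, (n <= k)%N & Q t k) ->
  exists2 K : nat -> nat, {homo K : a b / (a < b)%N} & forall t, Q t (K t).
Proof.
move=> H; pose f t n := sval (cid2 (H t n)).
have f1 t n : (n <= f t n)%N by rewrite /f; case: cid2.
have f2 t n : Q t (f t n) by rewrite /f; case: cid2.
pose K := fix K t := if t is t'.+1 then f t (K t').+1 else f 0%N 0%N.
exists K; last by case=> [|t]; exact: f2.
by apply: homo_ltn ltn_trans _ => t; exact: f1.
Qed.

End Sequences.

(** * Expectations of nonnegative functions *)

Section Integrals.
Context {R : realType} {d : measure_display} {T : measurableType d}.
Variable P : probability T R.
Local Open Scope ereal_scope.

(* On nonnegative functions, measurable or not, the library integral is a lower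
   integral, hence monotone. *)
Lemma ge0_le_integralT (f g : T -> \bar R) :
  (forall w, 0 <= f w) -> (forall w, f w <= g w) ->
  \int[P]_w f w <= \int[P]_w g w.
Proof.
move=> f0 fg.
have g0 w : 0 <= g w by exact: le_trans (fg w).
rewrite !ge0_integralTE//; apply: ereal_sup_le => _ [h hf <-].
by exists h => // w; exact: le_trans (fg w).
Qed.

Lemma measurable_dotvv p (V : T -> 'rV[R]_p) : random_vector V ->
  measurable_fun setT (fun w => dotv (V w) (V w)).
Proof.
move=> mV; apply: measurable_sum => j.
by apply: measurable_funM; exact: mV.
Qed.

Lemma expectation_sqr_enorm p (V : T -> 'rV[R]_p) :
  'E_P[fun w => (enorm (V w) ^+ 2)%R] = \int[P]_w (dotv (V w) (V w))%:E.
Proof. by rewrite unlock; apply: eq_integral => w _; rewrite sqr_enorm. Qed.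

Lemma ge0_integralD_EFin (f g : T -> R) :
  measurable_fun setT f -> (forall w, 0 <= f w)%R ->
  measurable_fun setT g -> (forall w, 0 <= g w)%R ->
  \int[P]_w (f w + g w)%:E = \int[P]_w (f w)%:E + \int[P]_w (g w)%:E.
Proof.
move=> mf f0 mg g0; under eq_integral do rewrite EFinD.
by rewrite ge0_integralD//; try exact/measurable_EFinP;
  move=> w _; rewrite lee_fin.
Qed.

Lemma ge0_integralM_EFin (b : R) (f : T -> R) :
  (0 <= b)%R -> measurable_fun setT f -> (forall w, 0 <= f w)%R ->
  \int[P]_w (b * f w)%:E = b%:E * \int[P]_w (f w)%:E.
Proof.
move=> b0 mf f0; under eq_integral do rewrite EFinM.
by rewrite ge0_integralZl_EFin//; try exact/measurable_EFinP;
  move=> w _; rewrite lee_fin.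
Qed.

Lemma ge0_integral_affine (a b : R) (q : T -> R) : (0 <= a)%R -> (0 <= b)%R ->
  measurable_fun setT q -> (forall w, 0 <= q w)%R ->
  \int[P]_w (a + b * q w)%:E = a%:E + b%:E * \int[P]_w (q w)%:E.
Proof.
move=> a0 b0 mq q0; rewrite (ge0_integralD_EFin (f := cst a))//.
- by rewrite ge0_integralM_EFin//= integral_cst//= probability_setT mule1.
- exact: measurable_funM.
- by move=> w; rewrite mulr_ge0.
Qed.

(** Integrate the pathwise bound; nonnegativity and measurability allow exchanging finite sums and
    integrals, and the convergent series of [b k * v k] bounds the errors uniformly in [N]. *)
Lemma expected_sum_le (gap err : nat -> T -> R) (h : T -> R) (b v : nat -> R)
    (c H : R) k0 :
  (forall k, 0 < b k)%R -> (0 <= c)%R ->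
  (forall k, measurable_fun setT (gap k)) -> (forall k w, 0 <= gap k w)%R ->
  (forall k, measurable_fun setT (err k)) -> (forall k w, 0 <= err k w)%R ->
  measurable_fun setT h -> (forall w, 0 <= h w)%R ->
  (forall N w, \sum_(k0 <= k < N) b k * gap k w <=
     h w + c * \sum_(k0 <= k < N) b k * err k w)%R ->
  \int[P]_w (h w)%:E <= H%:E ->
  (forall k, \int[P]_w (err k w)%:E <= (v k)%:E) ->
  \sum_(0 <= k <oo) (b k * v k)%:E < +oo ->
  exists M : R, forall N,
    \sum_(k0 <= k < N) (b k)%:E * \int[P]_w (gap k w)%:E <= M%:E.
Proof.
move=> b0 c0 mg g0 me e0 mh h0 gh hH ev bv.
have v0 k : (0 <= v k)%R.
  by rewrite -lee_fin (le_trans _ (ev k))// integral_ge0// => w _; rewrite lee_fin.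
have bv0 k : 0 <= (b k * v k)%:E by rewrite lee_fin mulr_ge0// ltW.
have SE : \sum_(0 <= k <oo) (b k * v k)%:E \is a fin_num.
  by rewrite ge0_fin_numE// nneseries_ge0.
exists (H + c * fine (\sum_(0 <= k <oo) (b k * v k)%:E))%R => N.
have sumI (f : nat -> T -> R) : (forall k, measurable_fun setT (f k)) ->
    (forall k w, 0 <= f k w)%R ->
  \int[P]_w (\sum_(k0 <= k < N) b k * f k w)%R%:E =
  \sum_(k0 <= k < N) (b k)%:E * \int[P]_w (f k w)%:E.
  move=> mf f0.
  under eq_integral do rewrite -sumEFin.
  rewrite ge0_integral_sum//; last 2 first.
  - move=> k; apply/measurable_EFinP; exact: measurable_funM.
  - by move=> k w _; rewrite lee_fin mulr_ge0// ltW.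
  by apply: eq_bigr => k _; rewrite ge0_integralM_EFin// ltW.
rewrite -sumI//.
apply: (@le_trans _ _ (\int[P]_w (h w + c * \sum_(k0 <= k < N) b k * err k w)%R%:E)).
  apply: ge0_le_integralT => w; rewrite lee_fin//.
  by apply: sumr_ge0 => k _; rewrite mulr_ge0// ltW.
have ms : measurable_fun setT (fun w => \sum_(k0 <= k < N) b k * err k w)%R.
  by apply: measurable_sum => k; exact: measurable_funM.
have s0 w : (0 <= \sum_(k0 <= k < N) b k * err k w)%R.
  by apply: sumr_ge0 => k _; rewrite mulr_ge0// ltW.
rewrite ge0_integralD_EFin//; last 2 first.
- exact: measurable_funM.
- by move=> w; rewrite mulr_ge0.
rewrite ge0_integralM_EFin//.
rewrite sumI// EFinD EFinM fineK// leeD// lee_wpmul2l//.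
apply: (@le_trans _ _ (\sum_(k0 <= k < N) (b k * v k)%:E)).
  by apply: lee_sum => k _; rewrite EFinM lee_wpmul2l// lee_fin ltW.
have [Nk|kN] := leqP N k0; first by rewrite big_geq// nneseries_ge0.
apply: (@le_trans _ _ (\sum_(0 <= k < N) (b k * v k)%:E)); last first.
  by apply: nneseries_lim_ge => k _ _; exact: bv0.
rewrite [leRHS](@big_cat_nat _ _ _ k0)//=; last exact: ltnW.
by rewrite leeDr// sume_ge0.
Qed.

End Integrals.

(** * Convergence *)

Lemma positive_range_bounds (R : realType) (s : nat) (c : nat -> 'I_s -> R) :
  (forall k i, 0 < c k i) ->
  (forall i, (0 < ereal_inf [set (c k i)%:E | k in [set: nat]])%E) ->
  (forall i, (ereal_sup [set (c k i)%:E | k in [set: nat]] < +oo)%E) ->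
  exists2 D : R, 0 < D & forall k i, c k i <= D /\ (c k i)^-1 <= D.
Proof.
move=> c0 cinf csup.
have /choice[D DP] i : exists D : R, 0 <= D /\
    forall k, c k i <= D /\ (c k i)^-1 <= D.
  have lec k : (ereal_inf [set (c k i)%:E | k in [set: nat]] <= (c k i)%:E)%E.
    by apply: ereal_inf_lbound; exists k.
  have gec k : ((c k i)%:E <= ereal_sup [set (c k i)%:E | k in [set: nat]])%E.
    by apply: ereal_sup_ubound; exists k.
  move: (cinf i) (csup i) lec gec.
  case: (ereal_inf _) => [l| |]//; last by move=> _ _ /(_ 0%N).
  case: (ereal_sup _) => [u| |]//; last by move=> _ _ _ /(_ 0%N).
  rewrite lte_fin => l0 _ lec gec.
  have {}lec k : l <= c k i by rewrite -lee_fin.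
  have {}gec k : c k i <= u by rewrite -lee_fin.
  have u0 : 0 <= u by apply: le_trans (gec 0%N); rewrite ltW.
  exists (u + l^-1); split => [|k]; first by rewrite addr_ge0// invr_ge0 ltW.
  split; first by rewrite (le_trans (gec k))// lerDl invr_ge0 ltW.
  by rewrite (@le_trans _ _ l^-1) ?lerDr// lef_pV2 ?posrE.
(* The added 1 keeps the bound positive even if there are no blocks. *)
exists (1 + \sum_i D i).
  by rewrite ltr_pwDl// sumr_ge0// => i _; have [] := DP i.
move=> k i; have DS : D i <= 1 + \sum_j D j.
  rewrite (bigD1 i)//= addrCA lerDl addr_ge0// sumr_ge0// => j _.
  by have [] := DP j.
by have [_ /(_ k)[cD cVD]] := DP i; split; exact: le_trans DS.
Qed.

(** Apply [divergent_weights_small] with [b] as both weights and values: square summability yields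
    one small term, and monotonicity the rest. *)
Lemma decreasing_small (R : realType) (b : nat -> R) :
  (forall k, 0 < b k) -> (forall k, b k.+1 <= b k) ->
  (\sum_(0 <= k <oo) (b k)%:E = +oo)%E ->
  (\sum_(0 <= k <oo) (b k ^+ 2)%:E < +oo)%E ->
  forall e, 0 < e -> exists n, forall k, (n <= k)%N -> b k <= e.
Proof.
move=> b0 bdecr bsum b2sum e e0.
have b2E k : (0 <= (b k ^+ 2)%:E)%E by rewrite lee_fin sqr_ge0.
have SE : (\sum_(0 <= k <oo) (b k ^+ 2)%:E \is a fin_num)%E.
  by rewrite ge0_fin_numE// nneseries_ge0.
have [||n _ bn] := @divergent_weights_small _ b (EFin \o b)
  (fine (\sum_(0 <= k <oo) (b k ^+ 2)%:E)%E) 0%N b0 bsum _ _ e 0%N e0.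
- by move=> k; rewrite lee_fin ltW.
- move=> N; rewrite fineK//.
  under eq_bigr do rewrite /= -EFinM -expr2.
  exact: nneseries_lim_ge.
rewrite lte_fin in bn; exists n => k nk; apply: le_trans (ltW bn).
by have /nonincreasing_seqP := bdecr; apply.
Qed.

Section Iterates.
Context {R : realType} {d dZ : measure_display}
  {T : measurableType d} {Z : measurableType dZ} {P : probability T R}
  {s : nat} {n_ : 'I_s -> nat}.
Variables (f : 'rV[R]_(\sum_i n_ i) -> Z -> R).
Variables (m : nat -> nat) (Xi : forall k, 'I_(m k) -> {RV P >-> Z}).
Variables (X : forall i, set 'rV[R]_(n_ i)) (r : forall i, 'rV[R]_(n_ i) -> R).
Arguments r : clear implicits.
Arguments X : clear implicits.
Variables (alpha : nat -> 'I_s -> R) (x : nat -> T -> 'rV[R]_(\sum_i n_ i)).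

(** On a constrained block [r i] is zero, so the chosen subgradient is zero and both updates solve
    the same minimization. *)
Lemma block_update_argmin k i w :
  X i = setT \/ (forall y, r i y = 0) ->
  block_update f Xi X r alpha x k i w ->
  argmin_on (X i)
    (fun y => dotv (sgrad f Xi x k i w) (y - submxrow (x k w) i)
      + (2 * alpha k i)^-1 * enorm (y - submxrow (x k w) i) ^+ 2 + r i y)
    (submxrow (x k.+1 w) i).
Proof.
move=> Xr [XT XnT]; have [/[dup] XiT ->|XiT] := pselect (X i = setT).
  exact: XT.
have r0 y : r i y = 0 by case: Xr.
have [v + [xX xmin]] := XnT XiT.
have -> : (fun y => (r i y)%:E) = fun=> 0%E by apply/funext => y; rewrite r0.
move=> /limiting_subdiff0 v0; split => // y yX.
by rewrite !r0 !addr0; have := xmin y yX; rewrite v0 addr0.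
Qed.

End Iterates.

Theorem theorem6 (R : realType) (d dZ : measure_display)
  (T : measurableType d) (Z : measurableType dZ) (P : probability T R)
  (s : nat) (n_ : 'I_s -> nat)
  (f : 'rV[R]_(\sum_i n_ i) -> Z -> R) (xi0 : {RV P >-> Z})
  (X : forall i, set 'rV[R]_(n_ i)) (r : forall i, 'rV[R]_(n_ i) -> R)
  (m : nat -> nat) (Xi : forall k, 'I_(m k) -> {RV P >-> Z})
  (c alpha : nat -> 'I_s -> R) (beta sigma : nat -> R)
  (x1 : 'rV[R]_(\sum_i n_ i)) (x : nat -> T -> 'rV[R]_(\sum_i n_ i))
  (A L rho : R) (Lr : 'I_s -> R)
  (F := expected_loss f xi0)
  (delta := grad_err f xi0 Xi x)
  (* the problem *)
  (f_int : forall y, P.-integrable setT (fun w => (f y (xi0 w))%:E))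
  (F_diff : forall y, differentiable F y)
  (F_C1 : continuous (grad F))
  (X_convex : forall i, @convex_set R 'rV[R]_(n_ i) (X i))
  (* the method *)
  (m_gt0 : forall k, (0 < m k)%N)
  (Xi_law : forall k (l : 'I_(m k)) (B : set Z), measurable B ->
     distribution P (@Xi k l) B = distribution P xi0 B)
  (x_bsg : bsg_sequence f Xi X r alpha x1 x)
  (* the stepsizes *)
  (alphaE : forall k i, alpha k i = c k i * beta k)
  (c_gt0 : forall k i, 0 < c k i)
  (beta_gt0 : forall k, 0 < beta k)
  (beta_decr : forall k, beta k.+1 <= beta k)
  (c_inf : forall i, (0 < ereal_inf [set (c k i)%:E | k in [set: nat]])%E)
  (c_sup : forall i, (ereal_sup [set (c k i)%:E | k in [set: nat]] < +oo)%E)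
  (beta_sum : (\sum_(0 <= k <oo) (beta k)%:E = +oo)%E)
  (beta_sqr_sum : (\sum_(0 <= k <oo) (beta k ^+ 2)%:E < +oo)%E)
  (* assumption (1) *)
  (delta_bias : forall k i, exists2 V : T -> 'rV[R]_(n_ i),
     is_cond_expectation P (history Xi k) (delta k i) V &
     {ae P, forall w, enorm (V w) <= A * \big[Num.max/0]_j alpha k j})
  (delta_var : forall k i,
     ('E_P[fun w => (enorm (delta k i w) ^+ 2)%R] <= (sigma k ^+ 2)%:E)%E)
  (* assumption (2) *)
  (Phi_lb : exists B : R, forall y, B <= objective F r y)
  (L_gt0 : 0 < L)
  (F_Lip : forall y z i,
     enorm (pgrad F i y - pgrad F i z) <= L * enorm (y - z))
  (* assumption (3) *)
  (x_bound : forall k, ('E_P[fun w => (enorm (x k w) ^+ 2)%R] <= (rho ^+ 2)%:E)%E)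
  (* assumption (4) *)
  (r_Lip : forall i y z, `|r i y - r i z| <= Lr i * enorm (y - z))
  (X_or_r : forall i, X i = setT \/ forall y, r i y = 0)
  (beta_sigma_sum : (\sum_(0 <= k <oo) (beta k * sigma k ^+ 2)%:E < +oo)%E) :
  exists2 K : nat -> nat, {homo K : a b / (a < b)%N} &
    (\int[P]_w edist_to 0 (limiting_subdiff (objective_hat F X r) (x (K t) w)))%E
      @[t --> \oo] --> 0%E.
Proof.
have [_ x_rv _ x_upd] := x_bsg.
have [D D0 cD] := positive_range_bounds c_gt0 c_inf c_sup.
have [H H0 PhiH] := objective_quadratic_bound F_diff L_gt0 F_Lip r_Lip.
have [B PhiB] := Phi_lb.
have x_argmin k i w := block_update_argmin (X_or_r i) (x_upd k i w).
have xX k w i : X i (submxrow (x k.+1 w) i) by have [] := x_argmin k i w.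
have alpha_gt0 k i : 0 < alpha k i by rewrite alphaE mulr_gt0.
have alpha_le k i : alpha k i <= D * beta k.
  by rewrite alphaE ler_pM2r//; have [] := cD k i.
have alpha_ge k i : (alpha k i)^-1 <= D / beta k.
  by rewrite alphaE invfM ler_pM2r ?invr_gt0//; have [] := cD k i.
(* Threshold below which [beta k] meets the smallness condition of [descent]; the added 1 covers
   [s = 0]. *)
pose e0 := (16 * (s%:R * L) * D + 1)^-1.
have sLD : 0 <= 16 * (s%:R * L) * D.
  by rewrite !mulr_ge0// ltW.
have e00 : 0 < e0 by rewrite invr_gt0 ltr_wpDl.
have [k1 k1P] := decreasing_small beta_gt0 beta_decr beta_sum beta_sqr_sum e00.
have beta_small k : (k1 <= k)%N -> 16 * (s%:R * L) * D * beta k <= 1.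
  move=> /k1P; rewrite /e0 -[leRHS]mul1r ler_pdivlMr ?ltr_wpDl//.
  by have := beta_gt0 k; lra.
(* Descent needs a feasible current iterate. Feasibility holds after an update, but the starting
   point need not lie in the constraint sets, so index 0 is skipped. *)
pose k0 := k1.+1.
pose G k w := gap F (x k w) (x k.+1 w) (fun i => sgrad f Xi x k i w) (beta k).
pose er k w := \sum_i dotv (delta k i w) (delta k i w).
have step_descent k w : (k0 <= k)%N -> beta k * G k w <=
    8 * D * (objective F r (x k w) - objective F r (x k.+1 w))
    + (8 * D ^+ 2 + 1) * (beta k * er k w).
  case: k => // k k0k.
  exact: (descent F_diff L_gt0 F_Lip (alpha_gt0 k.+1) (x_argmin k.+1 ^~ w) D0
    (beta_gt0 _) (alpha_le k.+1) (xX k w) (beta_small _ (ltnW k0k))).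
pose M := 4 * s%:R * L ^+ 2 * beta 0%N ^+ 2 + 2 * D ^+ 2 + 4.
have dist_le e k w : 0 < e ->
    (edist_to 0 (limiting_subdiff (objective_hat F X r) (x k.+1 w)) <=
     (e + M * G k w / e)%:E)%E.
  move=> e_gt0; apply: (edist_to_subdiff_le F_diff L_gt0 F_Lip X_convex X_or_r
    (alpha_gt0 k) (x_argmin k ^~ w) D0 (beta_gt0 k) (alpha_ge k) e_gt0).
  by have /nonincreasing_seqP := beta_decr; apply.
have x_meas k : measurable_fun setT (fun w => dotv (x k w) (x k w)).
  exact: measurable_dotvv.
(* Measurability of the error comes from the integrability contained in [is_cond_expectation]. *)
have er_meas k i : random_vector (delta k i).
  move=> j; have [V /(_ j)[di _ _ _] _] := delta_bias k i.
  exact/measurable_EFinP/(measurable_int P).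
have er_ge0 k w : 0 <= er k w by apply: sumr_ge0 => i _; exact: dotvv_ge0.
have er_mfun k : measurable_fun setT (er k).
  by apply: measurable_sum => i; exact: measurable_dotvv.
have step_meas k : random_vector (fun w => x k.+1 w - x k w).
  move=> j; under eq_fun do rewrite !mxE.
  by apply: measurable_funB; exact: x_rv.
have G_ge0 k w : 0 <= G k w.
  apply: addr_ge0; last by apply: sumr_ge0 => i _; exact: dotvv_ge0.
  by apply: mulr_ge0; rewrite ?dotvv_ge0// invr_ge0 sqr_ge0.
have G_meas k : measurable_fun setT (G k).
  apply: measurable_funD; last exact: er_mfun.
  by apply: measurable_funM => //; exact: measurable_dotvv.
have er_int k : (\int[P]_w (er k w)%:E <= (s%:R * sigma k ^+ 2)%:E)%E.
  under eq_integral do rewrite -sumEFin.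
  rewrite ge0_integral_sum//; last 2 first.
  - by move=> i; apply/measurable_EFinP; exact: measurable_dotvv.
  - by move=> i w _; rewrite lee_fin dotvv_ge0.
  have -> : (s%:R * sigma k ^+ 2)%:E = (\sum_(i < s) (sigma k ^+ 2)%:E)%E.
    by rewrite sumEFin sumr_const card_ord mulr_natl.
  apply: lee_sum => i _; by rewrite -expectation_sqr_enorm; exact: delta_var.
(* A nonnegative majorant, independent of [N], of [8 * D] times the telescoped decrease from [x k0]
   to [x N]. *)
pose h w := 8 * D * (H + `|B|) + 8 * D * H * dotv (x k0 w) (x k0 w).
have Dc : 0 <= 8 * D ^+ 2 + 1 by rewrite addr_ge0// mulr_ge0// sqr_ge0.
have DH0 : 0 <= 8 * D * H by rewrite !mulr_ge0// ltW.
have DB0 : 0 <= 8 * D * (H + `|B|).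
  by rewrite mulr_ge0 ?addr_ge0// mulr_ge0// ltW.
have h_meas : measurable_fun setT h.
  by apply: measurable_funD => //; exact: measurable_funM.
have h_ge0 w : 0 <= h w by rewrite addr_ge0// mulr_ge0// dotvv_ge0.
have descent_sum N w : \sum_(k0 <= k < N) beta k * G k w <=
    h w + (8 * D ^+ 2 + 1) * \sum_(k0 <= k < N) beta k * er k w.
  have [Nk|kN] := leqP N k0; first by rewrite !big_geq// mulr0 addr0.
  rewrite mulr_sumr.
  apply: le_trans (_ : _ <= \sum_(k0 <= k < N)
    (8 * D * (objective F r (x k w) - objective F r (x k.+1 w))
     + (8 * D ^+ 2 + 1) * (beta k * er k w))) _.
    by apply: ler_sum_nat => k /andP[kk _]; exact: step_descent.
  rewrite big_split/= lerD2r -mulr_sumr.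
  have -> : \sum_(k0 <= k < N) (objective F r (x k w) - objective F r (x k.+1 w))
      = objective F r (x k0 w) - objective F r (x N w).
    rewrite -opprB -(telescope_sumr (fun k => objective F r (x k w)) (ltnW kN)).
    rewrite -sumrN; by apply: eq_bigr => k _; rewrite opprB.
  rewrite /h -[8 * D * H * _]mulrA -mulrDr ler_pM2l ?mulr_gt0//.
  have := PhiH (x k0 w); have := PhiB (x N w); have := ler_norm (- B).
  rewrite normrN; lra.
have h_int : (\int[P]_w (h w)%:E <=
    (8 * D * (H + `|B|) + 8 * D * H * rho ^+ 2)%:E)%E.
  rewrite ge0_integral_affine// => [|w]; last exact: dotvv_ge0.
  rewrite EFinD leeD2l// [in leRHS]EFinM lee_wpmul2l//.
  by rewrite -expectation_sqr_enorm; exact: x_bound.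
have er_sum : (\sum_(0 <= k <oo) (beta k * (s%:R * sigma k ^+ 2))%:E < +oo)%E.
  under eq_eseriesr do rewrite mulrCA EFinM.
  rewrite nneseriesZl; last by move=> k _; rewrite lee_fin mulr_ge0 ?sqr_ge0// ltW.
  by rewrite lte_mul_pinfty// lee_fin.
have [C GC] := expected_sum_le beta_gt0 Dc G_meas G_ge0 er_mfun er_ge0 h_meas
  h_ge0 descent_sum h_int er_int er_sum.
(* The tolerance is squared because the distance bound divides the gap by [e], later taken to be
   [1 / (t + 1)]. *)
have [|K Kinc KP] := @increasing_choice
  (fun t k => (\int[P]_w (G k w)%:E < ((t.+1%:R^-1) ^+ 2)%:E)%E).
  move=> t n; apply: (divergent_weights_small beta_gt0 beta_sum _ GC).
    by move=> k; apply: integral_ge0 => w _; rewrite lee_fin.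
  by rewrite exprn_gt0// invr_gt0.
(* The gap at step [k] controls the subdifferential at the next iterate, hence the shift. *)
exists (fun t => (K t).+1); first by move=> a b ab; exact: Kinc.
have M0 : 0 <= M.
  rewrite addr_ge0// addr_ge0//; last by rewrite mulr_ge0 ?sqr_ge0.
  by rewrite mulr_ge0 ?sqr_ge0// mulr_ge0 ?sqr_ge0// mulr_ge0.
apply: (@squeeze_cvge _ _ _ _ (cst 0%E) _
  (fun t => ((1 + M) * t.+1%:R^-1)%:E)).
- apply: nearW => t; apply/andP; split.
    by apply: integral_ge0 => w _; exact: edist_to_ge0.
  pose e : R := t.+1%:R^-1; have e_gt0 : 0 < e by rewrite invr_gt0.
  have Me : 0 <= M / e by rewrite divr_ge0// ltW.
  apply: (@le_trans _ _ (\int[P]_w (e + M / e * G (K t) w)%:E)%E).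
    (* Measurability of the distance is not established; monotonicity of the lower integral
       suffices. *)
    apply: ge0_le_integralT => w; first exact: edist_to_ge0.
    by rewrite mulrAC; exact: dist_le.
  rewrite ge0_integral_affine ?(ltW e_gt0)//.
  apply: (@le_trans _ _ (e%:E + (M / e)%:E * (e ^+ 2)%:E)%E).
    by rewrite leeD2l// lee_wpmul2l// ltW// KP.
  rewrite -EFinM -EFinD lee_fin le_eqVlt; apply/orP; left; apply/eqP.
  by rewrite -/e; field; rewrite lt0r_neq0.
- exact: cvg_cst.
- apply: cvg_EFin; first exact: nearW.
  have cM : (1 + M) * harmonic t @[t --> \oo] --> (1 + M) * (0 : R).
    by apply: cvgMl_tmp; exact: cvg_harmonic.
  by rewrite mulr0 in cM; exact: cM.
Qed.
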